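(* Let $R$ be an associative ring with $1\neq 0$ and let $M$ be a left $R$-module. Then $M$ is divisible if and only if there exists a left ideal $I\leq R$ such that: (1) for every left ideal $J$ of $R$ with $J\leq I$, every left $R$-homomorphism $J\to M$ extends to a left $R$-homomorphism $I\to M$; (2) for every $r\in I$, every left $R$-homomorphism $Rr\to M$ extends to a left $R$-homomorphism $R\to M$; (3) for every $r\in R\setminus I$, every left $R$-homomorphism $Rr+I\to M$ extends to a left $R$-homomorphism $R\to M$.
   Context: A left $R$-module $M$ is divisible if for every principal left ideal $J$ of $R$ and every homomorphism of left $R$-modules $\varphi:J\to M$ there exists a homomorphism of left $R$-modules $\psi:R\to M$ with $\psi|_J=\varphi$. Modules are unital. *)

(* Defs.v *)
From HB Require Import structures.
From mathcomp Require Import all_boot all_algebra.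
From mathcomp Require Import boolp.

Set Implicit Arguments.
Unset Strict Implicit.
Unset Printing Implicit Defensive.

Import GRing.Theory.
Local Open Scope ring_scope.

(* A left ideal is a submodule of the left regular module R^o. Membership in a
   submodClosed is boolean; with the classical axioms of boolp this is no
   restriction, since any Prop-valued submodule becomes one through `[< _ >]. *)
Notation lideal R := (submodClosed R^o).

Section LeftIdeals.
Variable R : nzRingType.

(* Named so that the left R-module structure inherited from R^o is canonical,
   and homomorphisms I -> M are the library's {linear lideal_mod I -> M}. *)
Definition lideal_mod (I : lideal R) : Type := {x : R^o | x \in I}.

HB.instance Definition _ (I : lideal R) :=
  SubChoice.copy (lideal_mod I) {x : R^o | x \in I}.
HB.instance Definition _ (I : lideal R) :=
  [SubChoice_isSubLmodule of lideal_mod I by <:].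

Definition lideal_incl (J I : lideal R) (JI : {subset J <= I})
    (x : lideal_mod J) : lideal_mod I :=
  exist _ (val x) (JI _ (valP x)).

Definition lideal_of (P : pred R^o) (P_closed : submod_closed P) : lideal R :=
  HB.pack P (GRing.isSubmodClosed.Build R R^o P P_closed).

Definition lprincipal_pred (r : R) : pred R^o :=
  fun x => `[< exists a : R, x = a * r >].

Lemma lprincipal_submod_closed (r : R) : submod_closed (lprincipal_pred r).
Proof.
split=> [|a u v /asboolP[b ->] /asboolP[c ->]]; apply/asboolP.
  by exists 0; rewrite mul0r.
by exists (a * b + c); rewrite mulrDl -mulrA.
Qed.

Definition lprincipal (r : R) : lideal R :=
  lideal_of (lprincipal_submod_closed r).

Definition lideal_add_pred (J I : lideal R) : pred R^o :=
  fun x => `[< exists y z : R^o, [/\ y \in J, z \in I & x = y + z] >].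

Lemma lideal_add_submod_closed (J I : lideal R) :
  submod_closed (lideal_add_pred J I).
Proof.
split=> [|a u v /asboolP[y [z [yJ zI ->]]] /asboolP[y' [z' [yJ' zI' ->]]]];
  apply/asboolP.
  by exists 0, 0; rewrite !rpred0 addr0.
exists (a *: y + y'), (a *: z + z'); split; try by rewrite rpredD ?rpredZ.
by rewrite scalerDr addrACA.
Qed.

Definition lideal_add (J I : lideal R) : lideal R :=
  lideal_of (lideal_add_submod_closed J I).

Definition principal_lideal (J : lideal R) : Prop :=
  exists r : R, J =i lprincipal r.

Variable M : lmodType R.

Definition extends_to (J I : lideal R) (JI : {subset J <= I})
    (phi : {linear lideal_mod J -> M}) : Prop :=
  exists psi : {linear lideal_mod I -> M},
    forall x : lideal_mod J, psi (lideal_incl JI x) = phi x.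

Definition extends_to_ring (J : lideal R)
    (phi : {linear lideal_mod J -> M}) : Prop :=
  exists psi : {linear R^o -> M}, forall x : lideal_mod J, psi (val x) = phi x.

Definition divisible : Prop :=
  forall J : lideal R, principal_lideal J ->
  forall phi : {linear lideal_mod J -> M}, extends_to_ring phi.

End LeftIdeals.

Arguments divisible [R] M.

(* Main.v *)
(** For the converse, let [phi : Rr -> M] with [r] outside [I]. By (1) the
    restriction of [phi] to [Rr :&: I] extends to some [chi : I -> M]; the maps
    [phi] and [chi] agree on [Rr :&: I], so they glue to [Rr + I], and (3)
    applies. For the direct implication the zero ideal works. *)
Require Import Defs.
From HB Require Import structures.
From mathcomp Require Import all_boot all_algebra.
From mathcomp Require boolp.
Set Implicit Arguments.
Unset Strict Implicit.
Unset Printing Implicit Defensive.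
Import GRing.Theory.
Local Open Scope ring_scope.

Section LeftIdealTheory.
Variable R : nzRingType.
Implicit Types I J K : lideal R.

Lemma lideal_incl_linear J I (JI : {subset J <= I}) : linear (lideal_incl JI).
Proof. by move=> a x y; apply: val_inj. Qed.

HB.instance Definition _ J I (JI : {subset J <= I}) :=
  GRing.isLinear.Build R (lideal_mod J) (lideal_mod I) _ (lideal_incl JI)
    (lideal_incl_linear JI).

Lemma lideal_cap_submod_closed J I :
  submod_closed (fun x : R^o => (x \in J) && (x \in I)).
Proof.
split=> [|a u v]; first by rewrite unfold_in !rpred0.
by case/andP=> uJ uI /andP[vJ vI]; rewrite unfold_in !rpredD ?rpredZ.
Qed.

Definition lideal_cap J I : lideal R :=
  lideal_of (lideal_cap_submod_closed J I).

Lemma lideal_capSl J I : {subset lideal_cap J I <= J}.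
Proof. by move=> x /andP[]. Qed.

Lemma lideal_capSr J I : {subset lideal_cap J I <= I}.
Proof. by move=> x /andP[]. Qed.

Lemma lideal_addSl J I : {subset J <= lideal_add J I}.
Proof.
by move=> x xJ; apply/boolp.asboolP; exists x, 0; rewrite addr0 rpred0.
Qed.

Lemma lideal0_submod_closed : submod_closed (pred1 (0 : R^o)).
Proof.
split=> [|a u v /eqP-> /eqP->]; rewrite inE //.
by rewrite scaler0 addr0.
Qed.

Definition lideal0 : lideal R := lideal_of lideal0_submod_closed.

Lemma lideal_addr0 J : lideal_add J lideal0 =i J.
Proof.
move=> x; apply/idP/idP=> [|/lideal_addSl//].
by move=> /boolp.asboolP[y [z [yJ /eqP-> ->]]]; rewrite addr0.
Qed.

Variable M : lmodType R.

(** Reduces an extension problem over [R] to one over an intermediate ideal [K]. *)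
Lemma extends_to_ring_sub J K (JK : {subset J <= K})
    (phi : {linear lideal_mod J -> M}) :
  extends_to JK phi ->
  (forall psi : {linear lideal_mod K -> M}, extends_to_ring psi) ->
  extends_to_ring phi.
Proof.
case=> psi psiE /(_ psi)[chi chiE]; exists chi => x.
by rewrite -psiE -chiE.
Qed.

(** Ideals with the same elements may still have distinct carrier types; precomposing with the
    reverse inclusion transports [phi] between them. *)
Lemma extends_to_eq J K (JK : {subset J <= K}) (KJ : {subset K <= J})
  (phi : {linear lideal_mod J -> M}) : extends_to JK phi.
Proof.
exists (phi \o lideal_incl KJ : {linear _ -> _}) => x /=.
by congr (phi _); apply: val_inj.
Qed.

(** The extension sends [x + y] to [f x + g y]. Two decompositions of one element differ by an
    element of both ideals, where [f] and [g] agree. *)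
Lemma lideal_glue J I (f : {linear lideal_mod J -> M})
    (g : {linear lideal_mod I -> M}) :
  (forall (x : lideal_mod J) (y : lideal_mod I), val x = val y -> f x = g y) ->
  extends_to (@lideal_addSl J I) f.
Proof.
move=> fg.
have fgE (x : lideal_mod J) (y : lideal_mod I) x' y' :
      val x + val y = val x' + val y' -> f x + g y = f x' + g y'.
  move=> e; apply/eqP.
  rewrite -subr_eq0 opprD addrACA addr_eq0 -!raddfB -raddfN.
  apply/eqP/fg; rewrite raddfN !raddfB /=; apply/eqP.
  by rewrite -opprD -addr_eq0 addrACA -opprD subr_eq0; apply/eqP.
have dec (z : lideal_mod (lideal_add J I)) :
    exists p : lideal_mod J * lideal_mod I, val z = val p.1 + val p.2.
  case: z => z /= /[dup] zJI /boolp.asboolP[x [y [xJ yI ->]]].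
  by exists (exist _ x xJ, exist _ y yI).
(* The chosen decomposition [p] need not be additive; [h] is linear because, by [fgE], its values do
   not depend on the choice. *)
have [p pE] := boolp.choice dec.
pose h z := f (p z).1 + g (p z).2.
have h_lin : linear h.
  move=> a u v; rewrite /h scalerDr addrACA -!linearP; apply: fgE.
  by rewrite -pE !linearP /= !pE scalerDr addrACA.
pose hL := GRing.isLinear.Build R _ M _ h h_lin.
pose hh : {linear lideal_mod (lideal_add J I) -> M} := HB.pack h hL.
(* Compare the chosen decomposition of [x] with [x + 0]. *)
exists hh => x; rewrite /= /h -[RHS]addr0 -(raddf0 g); apply: fgE.
by rewrite -pE raddf0 addr0.
Qed.

End LeftIdealTheory.

Theorem lemma2p1 (R : nzRingType) (M : lmodType R) :
  divisible M <->
  exists I : lideal R,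
    [/\ forall (J : lideal R) (JI : {subset J <= I})
          (phi : {linear lideal_mod J -> M}), extends_to JI phi,
        forall r : R, (r : R^o) \in I ->
          forall phi : {linear lideal_mod (lprincipal r) -> M},
            extends_to_ring phi
      & forall r : R, (r : R^o) \notin I ->
          forall phi : {linear lideal_mod (lideal_add (lprincipal r) I) -> M},
            extends_to_ring phi].
Proof.
split=> [divM | [I [extI ext_in ext_notin]] J [r Jr] phi].
  (* An ideal inside 0 equals 0, and both [Rr] and [Rr + 0] are principal. *)
  exists (lideal0 R); split=> [J J0 phi|r _ phi|r _ phi].
  - apply: extends_to_eq => x /eqP->; exact: rpred0.
  - by apply: divM; exists r.
  - by apply: divM; exists r; apply: lideal_addr0.
(* [J] only shares its elements with [Rr], so [phi] is first moved to [Rr] itself. *)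
have Jsub : {subset J <= lprincipal r} by move=> x; rewrite Jr.
apply: (extends_to_ring_sub (JK := Jsub)) => [|{}phi].
  by apply: extends_to_eq => x; rewrite Jr.
have [rI | rNI] := boolP ((r : R^o) \in I); first exact: ext_in.
have [chi chiE] := extI _ (@lideal_capSr _ (lprincipal r) I)
  (phi \o lideal_incl (@lideal_capSl _ (lprincipal r) I) : {linear _ -> _}).
apply: (extends_to_ring_sub (JK := @lideal_addSl _ _ I) _ (ext_notin r rNI)).
apply: (lideal_glue (g := chi)) => x y xy.
have xI : val x \in lideal_cap (lprincipal r) I.
  by apply/andP; split; [exact: valP | rewrite xy; exact: valP].
(* [chiE] speaks only of elements included from the intersection, so [y] is put in that form. *)
have -> : y = lideal_incl (@lideal_capSr _ _ _) (exist _ (val x) xI).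
  exact: val_inj.
by rewrite chiE /=; congr (phi _); apply: val_inj.
Qed.
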